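(* Let $X=\operatorname{Cay}(\mathbb{Z}_n,\{\pm a,\pm b\})$ be a circulant graph of valency $4$. Then $X$ is unstable if and only if either $X$ is trivially unstable, or (perhaps after interchanging $a$ and $b$) one of the following holds: (1) $n\equiv 2\pmod 4$, $\gcd(a,n)=1$, and $b=ma+(n/2)$ for some $m\in\mathbb{Z}_n^\times$ with $m^2\equiv\pm1\pmod n$; or (2) $n$ is divisible by $8$ and $\gcd(|a|,|b|)=4$. Moreover, in both cases (1) and (2), $X$ has Wilson type (C.4), i.e., there exists $m\in\mathbb{Z}_n^\times$ with $(n/2)+m\{\pm a,\pm b\}=\{\pm a,\pm b\}$.
   Context: All graphs are finite, undirected and simple. $\operatorname{Cay}(\mathbb{Z}_n,S)$ (with $S\subseteq\mathbb{Z}_n\setminus\{0\}$, $S=-S$) has vertex set $\mathbb{Z}_n$ and $v\sim w$ iff $w-v\in S$. For $x\in\mathbb{Z}_n$, $|x|=n/\gcd(n,x)$ denotes the order of $x$ in $\mathbb{Z}_n$. The canonical bipartite double cover $BX$ has vertex set $V(X)\times\{0,1\}$, with $(v,0)\sim(w,1)$ iff $v\sim w$ in $X$. $X$ is unstable if $\operatorname{Aut}BX\neq\operatorname{Aut}X\times S_2$. A graph is twin-free if no two distinct vertices have the same neighbourhood. $X$ is nontrivially unstable if it is connected, nonbipartite, twin-free and unstable; it is trivially unstable if it is unstable but not nontrivially unstable (equivalently, it has more than one vertex and is disconnected, bipartite, or not twin-free). *)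

(* Defs.v *)
From HB Require Import structures.
From mathcomp Require Import all_boot all_order all_algebra all_fingroup.

Set Implicit Arguments.
Unset Strict Implicit.
Unset Printing Implicit Defensive.

Import GRing.Theory.
Local Open Scope ring_scope.

(* A finite simple graph is a symmetric irreflexive relation on a finType. *)

Section Graphs.
Variables (V : finType) (e : rel V).

Definition nbhd (v : V) : {set V} := [set w | e v w].

Definition has_valency (k : nat) : Prop := forall v, #|nbhd v| = k.

Definition graph_connected : Prop := forall v w, connect e v w.

Definition graph_bipartite : Prop :=
  exists A : {set V}, forall v w, e v w -> (v \in A) != (w \in A).

Definition twin_free : Prop := forall v w, nbhd v = nbhd w -> v = w.

Definition graph_aut : {set {perm V}} :=
  [set s : {perm V} | [forall v, forall w, e (s v) (s w) == e v w]].

Definition double_cover : rel (V * 'I_2) :=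
  fun p q => (p.2 != q.2) && e p.1 q.1.

End Graphs.

Section ProductPerm.
Variables (V : finType) (s : {perm V} * 'S_2).

Definition prod_perm_fun (p : V * 'I_2) : V * 'I_2 := (s.1 p.1, s.2 p.2).

Lemma prod_perm_fun_inj : injective prod_perm_fun.
Proof. by move=> [v i] [w j] [/perm_inj-> /perm_inj->]. Qed.

Definition prod_perm : {perm V * 'I_2} := perm prod_perm_fun_inj.

End ProductPerm.

Section Stability.
Variables (V : finType) (e : rel V).

(* Aut X x S_2, as the group of permutations (v, i) |-> (s v, t i) of the
   vertex set of the double cover. *)
Definition aut_times_S2 : {set {perm V * 'I_2}} :=
  [set prod_perm s | s in setX (graph_aut e) [set: 'S_2]].

Definition unstable : Prop := graph_aut (double_cover e) <> aut_times_S2.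

Definition nontrivially_unstable : Prop :=
  [/\ graph_connected e, ~ graph_bipartite e, twin_free e & unstable].

Definition trivially_unstable : Prop := unstable /\ ~ nontrivially_unstable.

End Stability.

(* 'Z_n is the ring of integers mod n only for n > 1. *)
Section Circulants.
Variable n : nat.

Definition Cay (S : {set 'Z_n}) : rel 'Z_n := fun v w => w - v \in S.

Definition pm_set (a b : 'Z_n) : {set 'Z_n} := [set a; - a; b; - b].

Definition Zn_order (x : 'Z_n) : nat := (n %/ gcdn n x)%N.

Definition case1 (a b : 'Z_n) : Prop :=
  [/\ n = 2 %[mod 4], gcdn a n = 1%N &
      exists m : 'Z_n, [/\ m \is a GRing.unit,
        m ^+ 2 = 1 \/ m ^+ 2 = -1 & b = m * a + (n %/ 2)%:R]].

Definition case2 (a b : 'Z_n) : Prop :=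
  (8 %| n)%N /\ gcdn (Zn_order a) (Zn_order b) = 4%N.

(* n/2 only makes sense for n even. *)
Definition wilson_C4 (S : {set 'Z_n}) : Prop :=
  ~~ odd n /\ exists2 m : 'Z_n, m \is a GRing.unit &
    [set (n %/ 2)%:R + m * s | s in S] = S.

End Circulants.

Lemma Cay_sym n (a b : 'Z_n) : symmetric (Cay (pm_set a b)).
Proof.
move=> v w; rewrite /Cay /pm_set -(opprB v w) !inE !eqr_oppLR !opprK.
by do !case: (_ == _).
Qed.

Lemma Cay_irr n (S : {set 'Z_n}) : 0 \notin S -> irreflexive (Cay S).
Proof. by move=> S0 v; rewrite /Cay subrr (negPf S0). Qed.

(* Main.v *)
Require Import Defs.
From HB Require Import structures.
From mathcomp Require Import all_boot all_order all_algebra all_fingroup.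
From mathcomp Require Import cyclic ring zify.
From Stdlib Require Classical_Prop.

(** If [X] is connected and nonbipartite, its double cover is connected, so an
automorphism of the double cover is, up to swapping the two sides, a pair
[(f, g)] of vertex permutations with [f x ~ g y] iff [x ~ y]; and [X] is
unstable iff some such pair has [f <> g].

Let [S] be the connection set. For odd [n], the involution [z |-> x + y - z]
shows that the number of common neighbours of [x] and [y] is odd iff
[(y - x) / 2] lies in [S]. Hence [f] preserves the relation
[(y - x) / 2 \in S], and by iteration the relations [(y - x) / 2 ^ k \in S];
when [2 ^ k = 1] modulo [n] this makes [f] an automorphism of [X], and [f = g]
if [X] is twin-free.

For even [n], exactly one of [a] and [b] is odd, say [a]. If [4 r <> 0], then
[x] is the only common neighbour of [x + r] and [x - r], so [g (x + r)] and
[g (x - r)] are opposite each other around [f x]. Parity then makes the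
4-cycles rigid, and the map [s |-> g (x + s) - f x] from [S] to [S] does not
depend on [x]: [f] is affine with some linear part [m], [g = f + n / 2], and
[m S + n / 2 = S]. If [n / 2] is odd, this shift exchanges [{a, - a}] and
[{b, - b}], which is family (1). If [n / 2] is even, then up to the sign of [m]
it fixes [a] and negates [b]; thus [(m - 1) a = (m + 1) b = n / 2], which
determines the 2-parts of the orders of [a] and [b] and gives family (2). *)

Set Implicit Arguments.
Unset Strict Implicit.
Unset Printing Implicit Defensive.

Import GRing.Theory.
Local Open Scope ring_scope.

Local Notation Zn_half n := ((n %/ 2)%:R : 'Z_n).

Lemma odd_card_involution (T : finType) (h : T -> T) (A : {set T}) :
  involutive h -> {in A, forall x, h x \in A} ->
  odd #|A| = odd #|[set x in A | h x == x]|.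
Proof.
move=> hK; have [k] := ubnP #|A|; elim: k A => // k IHk A leAk hA.
have [/exists_inP[x Ax hx]|/exists_inPn fixA] :=
  boolP [exists x in A, h x != x].
  have Dhx : h x \in A :\ x by rewrite !inE hx hA.
  have cardA : #|A| = #|A :\ x :\ h x|.+2.
    by rewrite (cardsD1 x A) Ax (cardsD1 (h x) (A :\ x)) Dhx.
  rewrite cardA /= negbK IHk; last 2 first.
  - by rewrite cardA in leAk; lia.
  - by move=> y; rewrite !inE (can_eq hK) (inv_eq hK) => /and3P[-> -> /hA->].
  congr (odd #|pred_of_set _|); apply/setP => y; rewrite !inE.
  have [->|yhx] /= := eqVneq y (h x).
    by rewrite hK eq_sym (negPf hx) andbF.
  by have [->|//] /= := eqVneq y x; rewrite (negPf hx) andbF.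
congr (odd #|pred_of_set _|); apply/setP => x; rewrite !inE.
by case Ax: (x \in A) => //=; rewrite (negbNE (fixA x Ax)).
Qed.

Lemma dvdn_pfactor_succ p i k d : prime p -> (p ^ i %| k)%N ->
  (d %| k * p)%N -> ~~ (d %| k)%N -> (p ^ i.+1 %| d)%N.
Proof.
move=> p_pr pik /dvdnP[x kpE] ndk; have p_gt0 := prime_gt0 p_pr.
have npx : ~~ (p %| x)%N.
  apply: contra ndk => /dvdnP[y xE]; apply/dvdnP; exists y.
  by apply/eqP; rewrite -(eqn_pmul2r p_gt0) kpE xE mulnAC.
have cop : coprime (p ^ i.+1) x by rewrite coprimeXl // prime_coprime.
by rewrite -(Gauss_dvdr d cop) -kpE expnSr dvdn_mul.
Qed.

(* The added multiple of [l] is divisible by exactly those primes of [n] that do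
   not divide [m]. *)
Lemma coprime_add_multiple m l n : (0 < m)%N -> (0 < n)%N -> coprime m l ->
  exists k, coprime (m + k * l) n.
Proof.
move=> m_gt0 n_gt0 cop_ml; pose k := (n`_(\pi(m)^'))%N; exists k.
rewrite /coprime eqn_leq gcdn_gt0 n_gt0 orbT andbT leqNgt; apply/negP=> gcd_gt1.
have p_pr := pdiv_prime gcd_gt1; set p := pdiv _ in p_pr.
have := pdiv_dvd (gcdn (m + k * l) n); rewrite -/p dvdn_gcd => /andP[p_sum pn].
have pk : (p %| k)%N = ~~ (p %| m)%N.
  have := pi_of_part (\pi(m)^') n_gt0 p; rewrite -/k !inE !mem_primes.
  by rewrite p_pr n_gt0 pn m_gt0 part_gt0.
have [pm|npm] := boolP (p %| m)%N; last first.
  by move: p_sum; rewrite dvdn_addl ?(negPf npm) // dvdn_mulr // pk.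
move: p_sum; rewrite dvdn_addr // Euclid_dvdM // pk pm /= => pl.
have : (p %| gcdn m l)%N by rewrite dvdn_gcd pm.
by rewrite (eqP cop_ml) (Euclid_dvd1 p_pr).
Qed.

Lemma coprime_odd_multiples A B : (0 < B)%N -> coprime A B -> odd A ->
  exists m u v, [/\ odd u, odd v, m = (2 * A * u).+1 &
    m = (2 * B * v).+1 \/ m.+1 = (2 * B * v)%N].
Proof.
move=> B_gt0 copAB odd_A; have [odd_B|even_B] := boolP (odd B).
  by exists (2 * A * B).+1, B, A; split=> //; left; rewrite mulnAC.
have copA2B : coprime A (2 * B) by rewrite coprimeMr coprimen2 odd_A.
pose w := chinese A (2 * B) 0 B.-1.
have /dvdnP[u wu] : (A %| w)%N by rewrite /dvdn (chinese_modl copA2B) mod0n.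
have wB : (w %% (2 * B))%N = B.-1.
  by rewrite (chinese_modr copA2B) modn_small //; lia.
pose v := (2 * (w %/ (2 * B)) + 1)%N.
have wv : w.+1 = (B * v)%N by rewrite (divn_eq w (2 * B)) wB /v; nia.
have odd_w : odd w.
  by have := congr1 odd wv; rewrite /= oddM (negPf even_B) /= => /negbFE.
exists (2 * w).+1, u, v; split=> //.
- by move: odd_w; rewrite wu oddM => /andP[].
- by rewrite /v oddD oddM.
- by rewrite wu; lia.
- by right; rewrite -mulnA -wv; lia.
Qed.

Lemma ord2P (i : 'I_2) : i = 0 \/ i = 1.
Proof. by case: i => [[|[|//]] lti]; [left|right]; apply: val_inj. Qed.

Lemma ord2_neqE (i j : 'I_2) : (i != j) = (j == i + 1).
Proof. by case: (ord2P i) (ord2P j) => -> [] ->. Qed.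

Lemma connect_ind (V : finType) (e : rel V) (P : V -> Prop) x :
  P x -> (forall v w, P v -> e v w -> P w) -> forall y, connect e x y -> P y.
Proof.
move=> Px Pe y /connectP[p + ->] {y}.
by elim: p x Px => //= v p IHp x Px /andP[exv]; apply: IHp; apply: Pe exv.
Qed.

Lemma connected_const (V : finType) (e : rel V) (T : Type) (F : V -> T) :
  graph_connected e -> (forall x y, e x y -> F x = F y) ->
  forall x y, F x = F y.
Proof.
move=> conn Fe x y.
apply: (connect_ind (P := fun z => F x = F z)) (conn x y) => //.
by move=> v w -> /Fe.
Qed.

Definition two_fold_aut (V : finType) (e : rel V) (f g : {perm V}) : Prop :=
  forall x y, e (f x) (g y) = e x y.

(* The two sides are swapped when [t = 1]. *)
Definition two_fold_lift (V : finType) (f g : {perm V}) (t : 'I_2)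
    (p : V * 'I_2) : V * 'I_2 :=
  (if p.2 == 0 then f p.1 else g p.1, p.2 + t).

Lemma two_fold_lift_inj (V : finType) (f g : {perm V}) (t : 'I_2) :
  injective (two_fold_lift f g t).
Proof.
move=> [x i] [y j] /eqP; rewrite xpair_eqE /= (inj_eq (addIr t)).
by case/andP=> /[swap] /eqP-> /eqP; case: (j == 0) => /perm_inj->.
Qed.

Section TwoFoldAutomorphisms.

Variables (V : finType) (e : rel V).
Hypothesis e_sym : symmetric e.

Lemma two_fold_autC f g : two_fold_aut e f g -> two_fold_aut e g f.
Proof. by move=> fg x y; rewrite e_sym fg e_sym. Qed.

Lemma nbhd_two_fold f g x : two_fold_aut e f g -> nbhd e (f x) = g @: nbhd e x.
Proof.
move=> fg; apply/setP => y; rewrite -[y](permKV g) mem_imset ?inE ?fg //.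
exact: perm_inj.
Qed.

Lemma card_common_nbhd_two_fold f g x y : two_fold_aut e f g ->
  #|nbhd e (f x) :&: nbhd e (f y)| = #|nbhd e x :&: nbhd e y|.
Proof.
move=> fg; rewrite !(nbhd_two_fold _ fg) -imsetI ?card_imset //.
  exact: perm_inj.
by move=> v w _ _; apply: perm_inj.
Qed.

Lemma twin_free_two_fold_eq f g : twin_free e ->
  two_fold_aut e f f -> two_fold_aut e f g -> f = g.
Proof.
move=> tfree ff fg; apply/permP => x; apply: tfree.
by rewrite (nbhd_two_fold _ ff) (nbhd_two_fold _ (two_fold_autC fg)).
Qed.

Lemma aut_times_S2_sub : aut_times_S2 e \subset graph_aut (double_cover e).
Proof.
apply/subsetP=> _ /imsetP[[u v] + ->].
rewrite !inE andbT /= => /'forall_forallP autu; apply/'forall_forallP=> p q.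
by rewrite !permE /double_cover /= (inj_eq perm_inj) (eqP (autu _ _)).
Qed.

Lemma two_fold_unstable f g : two_fold_aut e f g -> f != g -> unstable e.
Proof.
move=> fg nfg stab; have gf := two_fold_autC fg.
have : perm (@two_fold_lift_inj _ f g 0) \in graph_aut (double_cover e).
  rewrite inE; apply/'forall_forallP => -[x i] [y j].
  rewrite !permE /double_cover /two_fold_lift /= !addr0.
  by case: (ord2P i) (ord2P j) => -> [] ->; rewrite /= ?fg ?gf.
rewrite stab => /imsetP[[u v] _ /permP eq_lift].
case/eqP: nfg; apply/permP => x.
have := eq_lift (x, 0); have := eq_lift (x, 1).
by rewrite !permE /two_fold_lift /prod_perm_fun /= => -[-> _] [->].
Qed.

End TwoFoldAutomorphisms.

Section ConnectedNonbipartite.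

Variables (V : finType) (e : rel V).
Hypotheses (conn : graph_connected e) (nbip : ~ graph_bipartite e).

Lemma nonbipartite_card_gt0 : (0 < #|V|)%N.
Proof.
rewrite lt0n; apply: contra_notN nbip => /eqP/card0_eq V0.
by exists set0 => v; have := V0 v.
Qed.

Lemma double_cover_connected : graph_connected (double_cover e).
Proof.
move=> [x i] [y j]; pose C v k := connect (double_cover e) (x, i) (v, k).
have C_edge v w k : C v k -> e v w -> C w (k + 1).
  move=> Cvk evw; apply: connect_trans Cvk (connect1 _).
  by rewrite /double_cover /= ord2_neqE eqxx.
have reach v : exists k, C v k.
  apply: (connect_ind (P := fun v => exists k, C v k)) (conn x v).
    by exists i; apply: connect0.
  by move=> u w [k Cuk] /(C_edge _ _ _ Cuk) Cw; exists (k + 1).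
rewrite -/(C y j); apply: contra_notT nbip => nCyj.
have not_both v : C v i -> ~~ C v (i + 1).
  move=> Cvi; apply: contra nCyj => CvSi.
  have {Cvi CvSi} Cv k : C v k.
    by have [<-//|] := eqVneq i k; rewrite ord2_neqE => /eqP->.
  move: j.
  apply: (connect_ind (P := fun w => forall k, C w k)) (conn v y) => //.
  by move=> u w Cu euw k; rewrite -[k](subrK 1); apply: C_edge euw.
exists [set v | C v i] => v w evw; rewrite !inE; apply/eqP=> Cvw.
have [Cvi|nCvi] := boolP (C v i).
  have /not_both/negP[] : C w i by rewrite -Cvw.
  exact: C_edge evw.
have [k Cvk] := reach v; have ki : k != i by apply: contraNneq nCvi => <-.
rewrite ord2_neqE in ki.
by rewrite Cvw (eqP ki) (C_edge _ _ _ Cvk evw) in nCvi.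
Qed.

Lemma alternating_const (T : Type) (F0 F1 : V -> T) :
  (forall x y, e x y -> F0 x = F1 y) -> (forall x y, e x y -> F1 x = F0 y) ->
  forall x y, F0 x = F1 y.
Proof.
move=> F01 F10 x y; pose F p := if p.2 == 0 :> 'I_2 then F0 p.1 else F1 p.1.
apply: (connected_const double_cover_connected (F := F) _ (x, 0) (y, 1)).
move=> [v i] [w j] /andP[/=]; rewrite ord2_neqE /F /= => /eqP-> evw.
by case: (ord2P i) => ->; [exact: F01|exact: F10].
Qed.

Lemma double_cover_aut_side alpha : alpha \in graph_aut (double_cover e) ->
  exists t, forall p, (alpha p).2 = p.2 + t.
Proof.
rewrite inE => /'forall_forallP aut_a; pose side p := (alpha p).2 - p.2.
have side_const : forall p q, side p = side q.
  apply: (connected_const double_cover_connected) => p q epq.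
  have := epq; rewrite -(eqP (aut_a p q)) /double_cover !ord2_neqE.
  move=> /andP[/eqP aq _]; move: epq; rewrite /double_cover ord2_neqE /side.
  by case/andP=> /eqP-> _; rewrite aq opprD addrACA subrr addr0.
have /card_gt0P[x0 _] := nonbipartite_card_gt0.
by exists (side (x0, 0)) => p; rewrite (side_const _ p) /side addrC subrK.
Qed.

Lemma double_cover_aut_two_fold alpha :
  alpha \in graph_aut (double_cover e) ->
  exists f g t, two_fold_aut e f g /\ alpha =1 two_fold_lift f g t.
Proof.
move=> aut_a; have [t side] := double_cover_aut_side aut_a.
have inj i : injective (fun x => (alpha (x, i)).1).
  move=> x y eq1; have: alpha (x, i) = alpha (y, i).
    by apply: injective_projections; rewrite ?side.
  by move/perm_inj => [].
exists (perm (inj 0)), (perm (inj 1)), t; split=> [x y|[x i]].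
  move: aut_a; rewrite inE => /'forall_forallP/(_ (x, 0) (y, 1))/eqP.
  by rewrite /double_cover !side /= !permE (inj_eq (addIr t)).
apply: injective_projections; last by rewrite side.
by rewrite /two_fold_lift /=; case: (ord2P i) => -> /=; rewrite permE.
Qed.

Lemma unstable_two_fold : unstable e ->
  exists f g, two_fold_aut e f g /\ f != g.
Proof.
move=> unst; have [alpha aut_a nprod] : exists2 alpha,
    alpha \in graph_aut (double_cover e) & alpha \notin aut_times_S2 e.
  apply/exists_inP; apply: contra_notT unst => /exists_inPn sub.
  apply/eqP; rewrite eqEsubset aut_times_S2_sub andbT.
  by apply/subsetP => s /sub; rewrite negbK.
have [f [g [t [fg alphaE]]]] := double_cover_aut_two_fold aut_a.
exists f, g; split=> //; apply: contraNneq nprod => eqfg.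
rewrite -eqfg in fg alphaE.
apply/imsetP; exists (f, perm (addIr t)).
  by rewrite !inE andbT; apply/'forall_forallP => v w; rewrite fg.
apply/permP => p; rewrite alphaE !permE /two_fold_lift /prod_perm_fun /=.
by rewrite if_same permE.
Qed.

End ConnectedNonbipartite.

Lemma eq_of_subr_eq (V : zmodType) (u v x y : V) :
  u = v -> x - y = u - v -> x = y.
Proof. by move=> -> /eqP; rewrite subrr subr_eq0 => /eqP. Qed.

Section Zn.

Variable n : nat.
Hypothesis n_gt1 : (1 < n)%N.

Lemma Zn_natr_eq0 k : ((k%:R : 'Z_n) == 0) = (n %| k)%N.
Proof. by rewrite -val_eqE /= val_Zp_nat. Qed.

Lemma ltn_Zn (x : 'Z_n) : (x < n)%N.
Proof. by rewrite -[X in (_ < X)%N](Zp_cast n_gt1). Qed.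

Lemma Zn_order_dvd (x : 'Z_n) k : (k%:R * x == 0) = (Zn_order x %| k)%N.
Proof.
rewrite -{1}[x]natr_Zp -natrM Zn_natr_eq0 /Zn_order.
have g_gt0 : (0 < gcdn n x)%N by rewrite gcdn_gt0; lia.
rewrite -[RHS](dvdn_pmul2r g_gt0) divnK ?dvdn_gcdl // muln_gcdr dvdn_gcd.
by rewrite (dvdn_mull k (dvdnn n)).
Qed.

Lemma Zn_order_gt0 (x : 'Z_n) : (0 < Zn_order x)%N.
Proof.
have n_gt0 : (0 < n)%N := ltnW n_gt1.
by rewrite divn_gt0 ?gcdn_gt0 ?n_gt0 //; apply: dvdn_leq (dvdn_gcdl n x).
Qed.

Lemma Zn_order2_half (c : 'Z_n) :
  c + c = 0 -> c != 0 -> ~~ odd n /\ c = Zn_half n.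
Proof.
rewrite -[c]natr_Zp -natrD => /eqP; rewrite !Zn_natr_eq0 => /dvdnP[k Dk] ndvd.
have := ltn_Zn c; move: ndvd Dk; move: (nat_of_ord c) => {}c ndvd Dk lt_cn.
have c_neq0 : c <> 0%N by move=> c0; rewrite c0 dvdn0 in ndvd.
have k1 : k = 1%N by nia.
have -> : n = (c * 2)%N by lia.
by rewrite oddM andbF mulnK.
Qed.

Lemma Zn_half_neq0 : Zn_half n != 0.
Proof. by rewrite Zn_natr_eq0; apply/negP=> /dvdn_leq; lia. Qed.

Section EvenModulus.

Hypothesis even_n : ~~ odd n.

Lemma odd_Zn_natr k : odd (k%:R : 'Z_n) = odd k.
Proof. by rewrite val_Zp_nat // odd_mod // (negPf even_n). Qed.

Lemma odd_ZnD (x y : 'Z_n) : odd (x + y)%R = odd x (+) odd y.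
Proof.
by rewrite -[in LHS](natr_Zp x) -[in LHS](natr_Zp y) -natrD odd_Zn_natr oddD.
Qed.

Lemma odd_ZnN (x : 'Z_n) : odd (- x)%R = odd x.
Proof. by have := odd_ZnD x (- x); rewrite subrr /=; do 2!case: odd. Qed.

Lemma odd_ZnM (x y : 'Z_n) : odd (x * y)%R = odd x && odd y.
Proof.
by rewrite -[in LHS](natr_Zp x) -[in LHS](natr_Zp y) -natrM odd_Zn_natr oddM.
Qed.

Lemma odd_Zn1 : odd (1%R : 'Z_n).
Proof. exact: (odd_Zn_natr 1). Qed.

Lemma odd_Zn_sign (e : bool) (x : 'Z_n) : odd ((-1) ^+ e * x)%R = odd x.
Proof. by rewrite mulr_sign; case: e; rewrite ?odd_ZnN. Qed.

Lemma odd_Zn_unit (m : 'Z_n) : m \is a GRing.unit -> odd m.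
Proof.
rewrite -{1}[m]natr_Zp unitZpE // => /(coprime_dvdl (_ : 2 %| n)%N).
by rewrite coprime2n; apply; rewrite dvdn2.
Qed.

Lemma addr_Zn_half : Zn_half n + Zn_half n = 0.
Proof. by apply/eqP; rewrite -natrD Zn_natr_eq0 addnn -muln2 divnK ?dvdn2. Qed.

Lemma oppr_Zn_half : - Zn_half n = Zn_half n.
Proof. by apply/esym/eqP; rewrite -addr_eq0 addr_Zn_half. Qed.

Lemma mulr_Zn_half (x : 'Z_n) : x * Zn_half n = Zn_half n *+ odd x.
Proof.
rewrite -{1}[x]natr_Zp -[X in X%:R * _]odd_double_half -addnn !natrD !mulrDl.
by rewrite -mulrDr addr_Zn_half mulr0 addr0 mulr_natl.
Qed.

Lemma mulr_sign_Zn_half (e : bool) : (-1) ^+ e * Zn_half n = Zn_half n.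
Proof. by rewrite mulr_sign oppr_Zn_half if_same. Qed.

Lemma mulr_Zn_order_half (x : 'Z_n) k u :
  Zn_order x = (2 * k)%N -> odd u -> (k * u)%:R * x = Zn_half n.
Proof.
move=> ordx odd_u; have ord_gt0 := Zn_order_gt0 x.
have kx : k%:R * x = Zn_half n.
  apply: (Zn_order2_half _ _).2.
    by apply/eqP; rewrite -mulrDl -natrD Zn_order_dvd ordx mul2n addnn.
  by rewrite Zn_order_dvd; apply/negP=> /dvdn_leq; lia.
by rewrite natrM mulrAC kx mulrC mulr_Zn_half odd_Zn_natr odd_u.
Qed.

End EvenModulus.

End Zn.

Section CayleyGraphs.

Variables (n : nat) (S : {set 'Z_n}).

Lemma Cay_edge (P : 'Z_n -> 'Z_n -> Prop) :
  (forall x s, s \in S -> P x (x + s)) -> forall x y, Cay S x y -> P x y.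
Proof. by move=> PS x y /(PS x); rewrite addrC subrK. Qed.

Lemma Cay_symN : symmetric (Cay S) -> forall s, (- s \in S) = (s \in S).
Proof. by move=> S_sym s; have := S_sym s 0; rewrite /Cay sub0r subr0. Qed.

Lemma twin_free_aperiodic (d : 'Z_n) :
  twin_free (Cay S) -> {in S, forall s, s + d \in S} -> d = 0.
Proof.
move=> tfree Sd; apply: tfree; apply/setP=> w; rewrite !inE /Cay subr0.
rewrite -(mem_imset S (w - d) (addIr d)) /= subrK; congr (w \in pred_of_set _).
apply/eqP; rewrite eqEcard card_imset ?leqnn ?andbT; last exact: addIr.
by apply/subsetP=> _ /imsetP[s Ss ->]; apply: Sd.
Qed.

Section Connected.

Hypothesis conn : graph_connected (Cay S).

Lemma Cay_ind (P : 'Z_n -> Prop) :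
  P 0 -> (forall x s, P x -> s \in S -> P (x + s)) -> forall x, P x.
Proof.
move=> P0 PS x; apply: connect_ind (conn 0 x) => // v w Pv evw; move: Pv.
by apply: (Cay_edge (P := fun v w => P v -> P w)) evw => {}v s Ss Pv; apply: PS.
Qed.

Lemma Cay_annihilator_eq0 (p : 'Z_n) : {in S, forall s, p * s = 0} -> p = 0.
Proof.
move=> pS; rewrite -[p]mulr1; elim/Cay_ind: (1 : 'Z_n) => [|x s px Ss].
  by rewrite mulr0.
by rewrite mulrDr px pS ?addr0.
Qed.

Lemma Cay_divisor_unit (a : 'Z_n) :
  {in S, forall s, exists z, s = a * z} -> a \is a GRing.unit.
Proof.
move=> aS; suff [y ay] : exists y, 1 = a * y by apply/unitrPr; exists y.
elim/Cay_ind: (1 : 'Z_n) => [|x s [y ->] /aS[z ->]].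
  by exists 0; rewrite mulr0.
by exists (y + z); rewrite mulrDr.
Qed.

Lemma Cay_affine (f : 'Z_n -> 'Z_n) :
  (forall x s, s \in S -> f (x + s) = f x + (f s - f 0)) ->
  forall x, f x = f 0 + (f 1 - f 0) * x.
Proof.
move=> fS x; have fD y z : f (y + z) = f y + (f z - f 0).
  elim/Cay_ind: z => [|z s fz Ss]; first by rewrite addr0 subrr addr0.
  by rewrite addrA !(fS _ s) // fz; ring.
rewrite -[x]natr_Zp; elim: (nat_of_ord x) => [|k fk]; first by ring.
by rewrite -natr1 fD fk; ring.
Qed.

End Connected.

End CayleyGraphs.

Section Parity.

Variable n : nat.
Hypotheses (n_gt1 : (1 < n)%N) (even_n : ~~ odd n).

Lemma connected_odd_mem (S : {set 'Z_n}) :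
  graph_connected (Cay S) -> exists2 s, s \in S & odd s.
Proof.
move=> conn; apply/exists_inP; apply: contraT => /exists_inPn evenS.
suff : ~~ odd (1 : 'Z_n)%R by rewrite odd_Zn1.
elim/(Cay_ind conn): (1 : 'Z_n) => // x s even_x Ss.
by rewrite odd_ZnD // (negPf even_x) evenS.
Qed.

Lemma nonbipartite_even_mem (S : {set 'Z_n}) :
  ~ graph_bipartite (Cay S) -> exists2 s, s \in S & ~~ odd s.
Proof.
move=> nbip; apply/exists_inP; apply: contra_notT nbip => /exists_inPn oddS.
exists [set x : 'Z_n | odd x]; apply: Cay_edge => x s /oddS/negPn odd_s.
by rewrite !inE odd_ZnD // odd_s; case: odd.
Qed.

Lemma Zn_half_multiple_odd (S : {set 'Z_n}) (p : 'Z_n) :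
  graph_connected (Cay S) -> {in S, forall s, p * s = Zn_half n} ->
  {in S, forall s : 'Z_n, odd s}.
Proof.
move=> conn pS s Ss; have := Zn_half_neq0 n_gt1; rewrite -(pS s Ss).
apply: contraR => even_s; have p2 : p + p = 0.
  by apply: (Cay_annihilator_eq0 conn) => t St; rewrite mulrDl pS ?addr_Zn_half.
have [->|/(Zn_order2_half n_gt1 p2)[_ ->]] := eqVneq p 0.
  by rewrite mul0r.
by rewrite mulrC mulr_Zn_half // (negPf even_s).
Qed.

End Parity.

Lemma Cay_sym_preim_mul n (u : 'Z_n) (S : {set 'Z_n}) :
  symmetric (Cay S) -> symmetric (Cay ( *%R u @^-1: S)).
Proof.
by move=> S_sym x y; rewrite /Cay !inE -(Cay_symN S_sym) -mulrN opprB.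
Qed.

Section Halving.

Variables (n : nat) (h : 'Z_n).
Hypothesis addhh : h + h = 1.

Lemma midpointE (x y z : 'Z_n) : (x + y - z == z) = (z == h * (x + y)).
Proof.
rewrite subr_eq; apply/eqP/eqP => [->|->]; last by rewrite -mulrDl addhh mul1r.
by rewrite mulrDr -mulrDl addhh mul1r.
Qed.

(* The common neighbours of [x] and [y] are paired off by [z |-> x + y - z],
   which fixes only the midpoint of [x] and [y]. *)
Lemma odd_card_common_nbhd (S : {set 'Z_n}) x y : symmetric (Cay S) ->
  odd #|nbhd (Cay S) x :&: nbhd (Cay S) y| = (h * (y - x) \in S).
Proof.
move=> S_sym; set A := _ :&: _; pose mid := h * (x + y).
have inA z : (z \in A) = (z - x \in S) && (z - y \in S) by rewrite !inE.
rewrite (@odd_card_involution _ (fun z => x + y - z)); first last.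
- move=> z; rewrite !inA -(Cay_symN S_sym (z - x)) -(Cay_symN S_sym (z - y)).
  case/andP=> Sx Sy; apply/andP; split.
    by have -> : x + y - z - x = - (z - y) by ring.
  by have -> : x + y - z - y = - (z - x) by ring.
- exact: subKr.
have midx : mid - x = h * (y - x).
  by rewrite -[x in LHS]mul1r -addhh /mid; ring.
have midy : mid - y = - (h * (y - x)).
  by rewrite -[y in LHS]mul1r -addhh /mid; ring.
have Amid : (mid \in A) = (h * (y - x) \in S).
  by rewrite inA midx midy Cay_symN ?andbb.
have -> : [set z in A | x + y - z == z] = A :&: [set mid].
  by apply/setP=> z; rewrite in_setI in_set1 in_set midpointE.
rewrite (cardsD1 mid) -setIDA setDv setI0 cards0 addn0 in_setI set11 andbT.
by rewrite oddb Amid.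
Qed.

Lemma two_fold_aut_preim_mul (S : {set 'Z_n}) f g : symmetric (Cay S) ->
  two_fold_aut (Cay S) f g -> two_fold_aut (Cay ( *%R h @^-1: S)) f f.
Proof.
move=> S_sym fg x y; rewrite /Cay !inE -!odd_card_common_nbhd //.
by rewrite (card_common_nbhd_two_fold _ _ fg).
Qed.

Lemma two_fold_aut_preim_mulX (S : {set 'Z_n}) f g k : symmetric (Cay S) ->
  two_fold_aut (Cay S) f g -> two_fold_aut (Cay ( *%R (h ^+ k.+1) @^-1: S)) f f.
Proof.
move=> S_sym fg; elim: k => [|k IHk]; first exact: two_fold_aut_preim_mul fg.
have -> : *%R (h ^+ k.+2) @^-1: S = *%R h @^-1: ( *%R (h ^+ k.+1) @^-1: S).
  by apply/setP=> s; rewrite !inE mulrA -exprSr.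
by apply: two_fold_aut_preim_mul IHk; apply: Cay_sym_preim_mul.
Qed.

End Halving.

Lemma odd_twin_free_two_fold_eq n (S : {set 'Z_n}) f g :
  (1 < n)%N -> odd n -> symmetric (Cay S) -> twin_free (Cay S) ->
  two_fold_aut (Cay S) f g -> f = g.
Proof.
move=> n_gt1 odd_n S_sym tfree fg.
have two_unit : (2%:R : 'Z_n) \is a GRing.unit by rewrite unitZpE // coprimen2.
have halfP : (2%:R : 'Z_n)^-1 + 2%:R^-1 = 1.
  by rewrite -mulr2n -[LHS]mulr_natl divrr.
have := two_fold_aut_preim_mulX halfP (totient n).-1 S_sym fg.
rewrite prednK ?totient_gt0 ?(ltnW n_gt1) // exprVn -natrX.
rewrite -(Zp_nat_mod n_gt1) Euler_exp_totient ?coprime2n // Zp_nat_mod // invr1.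
have -> : *%R 1 @^-1: S = S by apply/setP=> s; rewrite inE mul1r.
by move=> ff; apply: twin_free_two_fold_eq ff fg.
Qed.

Lemma wilson_C4I n (S : {set 'Z_n}) (m : 'Z_n) :
  ~~ odd n -> m \is a GRing.unit ->
  {in S, forall s, Zn_half n + m * s \in S} -> wilson_C4 S.
Proof.
move=> even_n mU mS; split=> //; exists m => //.
have shift_inj : injective (fun s => Zn_half n + m * s).
  by move=> s t /addrI/(mulrI mU).
apply/eqP; rewrite eqEcard card_imset // leqnn andbT.
by apply/subsetP=> _ /imsetP[s Ss ->]; apply: mS.
Qed.

Section StepImages.

Variables (n : nat) (S : {set 'Z_n}).
Implicit Types f g : {perm 'Z_n}.

Definition step_image f g (x s : 'Z_n) : 'Z_n := g (x + s) - f x.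

Lemma step_image_in f g x s :
  two_fold_aut (Cay S) f g -> s \in S -> step_image f g x s \in S.
Proof.
by move=> fg Ss; have := fg x (x + s); rewrite /Cay addrAC subrr add0r Ss.
Qed.

Lemma step_image_inj f g x : injective (step_image f g x).
Proof. by move=> s t /addIr/perm_inj/addrI. Qed.

Lemma step_image_back f g x s :
  step_image g f (x + s) (- s) = - step_image f g x s.
Proof. by rewrite /step_image addrK opprB. Qed.

(* By hypothesis [x] is the only common neighbour of [x + r] and [x - r], hence
   [f x] is the only common neighbour of [g (x + r)] and [g (x - r)]. *)
Lemma step_image_opp_unique f g x r :
  symmetric (Cay S) -> two_fold_aut (Cay S) f g -> r \in S ->
  (forall u, u \in S -> u + (r + r) \in S -> u = - r) ->
  step_image f g x (- r) = - step_image f g x r.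
Proof.
move=> S_sym fg Sr r_unique; have SN := Cay_symN S_sym.
pose z := g (x + r) + g (x - r) - f x; pose w := (f^-1)%g z.
have fw : f w = z by rewrite permKV.
have nbr_w y : g y - z \in S -> y - w \in S.
  by rewrite -fw; have := fg w y; rewrite /Cay => ->.
have Sxr : x + r - w \in S.
  apply: nbr_w; suff -> : g (x + r) - z = - step_image f g x (- r).
    by rewrite SN step_image_in ?SN.
  by rewrite /z /step_image; ring.
have Sx_r : x - r - w \in S.
  apply: nbr_w; suff -> : g (x - r) - z = - step_image f g x r.
    by rewrite SN step_image_in.
  by rewrite /z /step_image; ring.
have /(r_unique _ Sx_r) eq_w : x - r - w + (r + r) \in S.
  by have -> : x - r - w + (r + r) = x + r - w by ring.
have wx : w = x by apply: (eq_of_subr_eq (esym eq_w)); ring.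
rewrite wx in fw; apply: (eq_of_subr_eq (esym fw)).
by rewrite /z /step_image; ring.
Qed.

(* That is, [f x + f (x + s + t) = g (x + s) + g (x + t)]. *)
Definition preserves_parallelograms f g : Prop := forall x s t,
  s \in S -> t \in S -> step_image g f (x + s) t = step_image f g x t.

Section ParallelogramPreserving.

Variables f g : {perm 'Z_n}.
Hypotheses (n_gt1 : (1 < n)%N) (conn : graph_connected (Cay S)).
Hypotheses (nbip : ~ graph_bipartite (Cay S)) (fg : two_fold_aut (Cay S) f g).
Hypotheses (par_fg : preserves_parallelograms f g).
Hypotheses (par_gf : preserves_parallelograms g f).

Lemma step_image_const x y t :
  t \in S -> step_image f g x t = step_image g f y t.
Proof.
move=> St; move: x y; apply: (alternating_const conn nbip); apply: Cay_edge.
  by move=> x s Ss; rewrite par_fg.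
by move=> x s Ss; rewrite par_gf.
Qed.

Lemma two_fold_diff_const x y : g x - f x = f y - g y.
Proof.
move: x y; apply: (alternating_const conn nbip); apply: Cay_edge => x s Ss.
  apply: (eq_of_subr_eq (step_image_const x x Ss)).
  by rewrite /step_image; ring.
apply: (eq_of_subr_eq (esym (step_image_const x x Ss))).
by rewrite /step_image; ring.
Qed.

Hypothesis nfg : f != g.

Lemma two_fold_diff_half : ~~ odd n /\ forall x, g x = f x + Zn_half n.
Proof.
pose c x := g x - f x.
have c2 x : c x + c x = 0.
  by apply: (eq_of_subr_eq (two_fold_diff_const x x)); rewrite /c; ring.
have c_neq0 x : c x != 0.
  apply: contra_neq nfg => c0; apply/permP=> y; apply/esym/subr0_eq.
  by rewrite (two_fold_diff_const y x) -opprB -/(c x) c0 oppr0.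
split=> [|x]; first exact: (Zn_order2_half n_gt1 (c2 0) (c_neq0 0)).1.
by rewrite -(Zn_order2_half n_gt1 (c2 x) (c_neq0 x)).2 addrC subrK.
Qed.

Lemma two_fold_wilson_C4 : wilson_C4 S.
Proof.
have [even_n gE] := two_fold_diff_half.
pose m := f 1 - f 0; have fE x : f x = f 0 + m * x.
  apply: (Cay_affine conn) => {}x s Ss; have := step_image_const x 0 Ss.
  rewrite -(step_image_const 0 0 Ss) /step_image !gE add0r => eq_step.
  by apply: (eq_of_subr_eq eq_step); ring.
apply: (wilson_C4I even_n (m := m)) => [|s Ss].
  pose w := (f^-1)%g (f 0 + 1); apply/unitrPr; exists w.
  by apply: (addrI (f 0)); rewrite -fE permKV.
have := step_image_in 0 fg Ss; rewrite /step_image add0r gE fE.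
by congr (_ \in pred_of_set S); ring.
Qed.

End ParallelogramPreserving.

End StepImages.

Section PmSet.

Variables (n : nat) (a b : 'Z_n).

Lemma in_pm_set u :
  (u \in pm_set a b) = [|| u == a, u == - a, u == b | u == - b].
Proof. by rewrite !inE -!orbA. Qed.

Lemma pm_setC : pm_set b a = pm_set a b.
Proof. by apply/setP=> u; rewrite !inE; do 4!case: (_ == _). Qed.

Lemma pm_setP u :
  reflect (exists e : bool, u = (-1) ^+ e * a \/ u = (-1) ^+ e * b)
          (u \in pm_set a b).
Proof.
rewrite in_pm_set; apply: (iffP or4P) => [[]/eqP->|[e]].
- by exists false; left; rewrite mul1r.
- by exists true; left; rewrite mulN1r.
- by exists false; right; rewrite mul1r.
- by exists true; right; rewrite mulN1r.
rewrite !mulr_sign; case: e => -[] ->.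
- by constructor 2.
- by constructor 4.
- by constructor 1.
- by constructor 3.
Qed.

Lemma pm_set_dbl_neq0 : #|pm_set a b| = 4 ->
  {in pm_set a b, forall s, s + s != 0}.
Proof.
rewrite /pm_set -!setUA !cardsU1 cards1 !inE => card4 s Ss.
have [aNa bNb] : a != - a /\ b != - b.
  by move: card4; do 6!case: (_ == _).
by move: Ss; rewrite !inE addr_eq0 => /or4P[] /eqP->; rewrite ?opprK // eq_sym.
Qed.

Lemma pm_set_left : a \in pm_set a b.
Proof. by rewrite in_pm_set eqxx. Qed.

Lemma pm_set_right : b \in pm_set a b.
Proof. by rewrite in_pm_set eqxx !orbT. Qed.

Lemma pm_setN u : (- u \in pm_set a b) = (u \in pm_set a b).
Proof. exact: Cay_symN (Cay_sym a b) u. Qed.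

End PmSet.

Lemma pm_set_divisor_unit n (a z : 'Z_n) :
  graph_connected (Cay (pm_set a (a * z))) -> a \is a GRing.unit.
Proof.
move=> conn; apply: (Cay_divisor_unit conn) => _ /pm_setP[e [->|->]].
  by exists ((-1) ^+ e); rewrite mulrC.
by exists ((-1) ^+ e * z); rewrite mulrCA.
Qed.

Section OneOddGenerator.

Variables (n : nat) (a b : 'Z_n).
Hypotheses (n_gt1 : (1 < n)%N) (even_n : ~~ odd n).
Hypotheses (odd_a : odd a) (even_b : ~~ odd b).
Local Notation S := (pm_set a b).

Lemma pm_set_odd u : u \in S -> odd u -> exists e : bool, u = (-1) ^+ e * a.
Proof.
case/pm_setP=> e [->|->]; first by exists e.
by rewrite odd_Zn_sign // (negPf even_b).
Qed.

Lemma pm_set_even u : u \in S -> ~~ odd u -> exists e : bool, u = (-1) ^+ e * b.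
Proof.
by case/pm_setP=> e [->|->]; [rewrite odd_Zn_sign // odd_a|exists e].
Qed.

Lemma pm_set_same_parity s t :
  s \in S -> t \in S -> odd s = odd t -> t = s \/ t = - s.
Proof.
rewrite !in_pm_set => /or4P[] /eqP-> /or4P[] /eqP->;
  by rewrite ?odd_ZnN // ?odd_a ?(negPf even_b) ?opprK; auto.
Qed.

Lemma pm_set_cases s t u : s \in S -> t \in S -> u \in S -> odd s != odd t ->
  [\/ u = s, u = - s, u = t | u = - t].
Proof.
move=> Ss St Su odd_st; have [odd_us|odd_us] := eqVneq (odd s) (odd u).
  case: (pm_set_same_parity Ss Su odd_us) => ->; first by constructor 1.
  by constructor 2.
have odd_ut : odd t = odd u by move: odd_st odd_us; do 3!case: odd.
case: (pm_set_same_parity St Su odd_ut) => ->; first by constructor 3.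
by constructor 4.
Qed.

Hypotheses (card_S : #|S| = 4) (tfree : twin_free (Cay S)).

Let dbl_neq0 := pm_set_dbl_neq0 card_S.

Lemma pm_set_dbl_neq s t : s \in S -> t \in S -> odd s != odd t ->
  s + s != t + t.
Proof.
move=> Ss St odd_st; apply/eqP=> st2.
suff /subr0_eq eq_st : s - t = 0 by rewrite eq_st eqxx in odd_st.
apply: (twin_free_aperiodic tfree) => u Su.
case: (pm_set_cases Ss St Su odd_st) => ->.
- by have -> : s + (s - t) = t by apply: (eq_of_subr_eq st2); ring.
- by have -> : - s + (s - t) = - t; [ring|rewrite pm_setN].
- by have -> : t + (s - t) = s by ring.
have -> : - t + (s - t) = - s by apply: (eq_of_subr_eq st2); ring.
by rewrite pm_setN.
Qed.

Lemma pm_set_parallelogram s t u v :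
  s \in S -> t \in S -> u \in S -> v \in S -> odd s != odd t ->
  s + u = t + v -> u = - s \/ u = t.
Proof.
move=> Ss St Su Sv odd_st sutv; have st2 := pm_set_dbl_neq Ss St odd_st.
case: (pm_set_cases Ss St Su odd_st) => eq_u;
  [exfalso|by left|by right|exfalso].
- have Dv : v = s + s - t.
    by apply: (eq_of_subr_eq (esym sutv)); rewrite eq_u; ring.
  have odd_v : odd t = odd v by rewrite Dv !odd_ZnD // odd_ZnN // addbb.
  case: (pm_set_same_parity St Sv odd_v) => eq_v.
    by case/eqP: st2; apply: (eq_of_subr_eq eq_v); rewrite Dv; ring.
  by case/eqP: (dbl_neq0 Ss); apply: (eq_of_subr_eq eq_v); rewrite Dv; ring.
have Dv : v = s - (t + t).
  by apply: (eq_of_subr_eq (esym sutv)); rewrite eq_u; ring.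
have odd_v : odd s = odd v.
  by rewrite Dv odd_ZnD // odd_ZnN // odd_ZnD // addbb addbF.
case: (pm_set_same_parity Ss Sv odd_v) => eq_v.
  case/eqP: (dbl_neq0 St); apply: (eq_of_subr_eq (esym eq_v)).
  by rewrite Dv; ring.
by case/eqP: st2; apply: (eq_of_subr_eq eq_v); rewrite Dv; ring.
Qed.

Lemma pm_set_unique_step r : r \in S -> r *+ 4 != 0 ->
  forall u, u \in S -> u + (r + r) \in S -> u = - r.
Proof.
move=> Sr r4 u Su Sur; have r2 := dbl_neq0 Sr.
have odd_ur : odd u = odd (u + (r + r))%R.
  by rewrite !odd_ZnD // addbb addbF.
case: (pm_set_same_parity Su Sur odd_ur) => eq_ur.
  by case/eqP: r2; apply: (eq_of_subr_eq eq_ur); ring.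
have ur2 : u + u = - r - r by apply: (eq_of_subr_eq eq_ur); ring.
have [odd_r|odd_r] := eqVneq (odd r) (odd u); last first.
  have /eqP[] : u + u != - r - r; last exact: ur2.
  by apply: pm_set_dbl_neq; rewrite ?pm_setN ?odd_ZnN // eq_sym.
case: (pm_set_same_parity Sr Su odd_r) => // eq_u; case/eqP: r4.
by apply: (eq_of_subr_eq ur2); rewrite eq_u; ring.
Qed.

Lemma pm_set_mul4_neq0 : exists2 r, r \in S & r *+ 4 != 0.
Proof.
have [Sa Sb] := (pm_set_left a b, pm_set_right a b).
have [a4|] := eqVneq (a *+ 4) 0; last by exists a.
have [b4|] := eqVneq (b *+ 4) 0; last by exists b.
have dbl_half u : u \in S -> u *+ 4 = 0 -> u + u = Zn_half n.
  move=> /dbl_neq0 u2 u4; apply: (Zn_order2_half n_gt1 _ u2).2.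
  by rewrite -u4; ring.
have odd_ab : odd a != odd b by rewrite odd_a (negPf even_b).
by case/eqP: (pm_set_dbl_neq Sa Sb odd_ab); rewrite !dbl_half.
Qed.

Implicit Types f g : {perm 'Z_n}.

Lemma odd_step_image_neq f g x s t :
  two_fold_aut (Cay S) f g -> s \in S -> t \in S ->
  step_image f g x (- s) = - step_image f g x s -> odd s != odd t ->
  odd (step_image f g x s) != odd (step_image f g x t).
Proof.
move=> fg Ss St opp_s; have Sstep := step_image_in x fg.
apply: contra_neq => /(pm_set_same_parity (Sstep s Ss) (Sstep t St))[|].
  by move/step_image_inj->.
by rewrite -opp_s => /step_image_inj->; rewrite odd_ZnN.
Qed.

Lemma step_image_opp f g x s : two_fold_aut (Cay S) f g -> s \in S ->
  step_image f g x (- s) = - step_image f g x s.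
Proof.
move=> fg Ss; have [r Sr r4] := pm_set_mul4_neq0.
have SNs : - s \in S by rewrite pm_setN.
have Sstep := step_image_in x fg.
have opp_r : step_image f g x (- r) = - step_image f g x r.
  apply: (step_image_opp_unique x (Cay_sym a b) fg Sr).
  exact: pm_set_unique_step Sr r4.
have [odd_rs|odd_rs] := eqVneq (odd r) (odd s).
  case: (pm_set_same_parity Sr Ss odd_rs) => -> //.
  by rewrite opp_r !opprK.
have neq_s := odd_step_image_neq fg Sr Ss opp_r odd_rs.
have neq_Ns : odd (step_image f g x r) != odd (step_image f g x (- s)).
  by apply: odd_step_image_neq; rewrite ?odd_ZnN.
have eq_sNs : odd (step_image f g x s) = odd (step_image f g x (- s)).
  by move: neq_s neq_Ns; do 3!case: odd.
case: (pm_set_same_parity (Sstep s Ss) (Sstep _ SNs) eq_sNs) => //.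
by move/step_image_inj/eqP; rewrite eq_sym -addr_eq0 (negPf (dbl_neq0 Ss)).
Qed.

Lemma pm_set_preserves_parallelograms f g :
  two_fold_aut (Cay S) f g -> preserves_parallelograms S f g.
Proof.
move=> fg x s t Ss St; have gf := two_fold_autC (Cay_sym a b) fg.
have [odd_st|odd_st] := eqVneq (odd s) (odd t).
  case: (pm_set_same_parity Ss St odd_st) => ->.
    by rewrite -[LHS]opprK -step_image_opp // step_image_back opprK.
  by rewrite step_image_back step_image_opp.
have odd_step := odd_step_image_neq fg Ss St (step_image_opp x fg Ss) odd_st.
have closed : step_image f g x s + step_image g f (x + s) t
            = step_image f g x t + step_image g f (x + t) s.
  by rewrite /step_image (addrAC x t s); ring.
case: (pm_set_parallelogram _ _ _ _ odd_step closed) => //.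
- exact: step_image_in.
- exact: step_image_in.
- exact: step_image_in.
- exact: step_image_in.
rewrite -step_image_back => /step_image_inj eq_t.
by rewrite eq_t odd_ZnN // eqxx in odd_st.
Qed.

End OneOddGenerator.

Section WilsonType.

Variable n : nat.
Hypothesis n_gt1 : (1 < n)%N.

Lemma wilson_C4_unstable (S : {set 'Z_n}) :
  symmetric (Cay S) -> wilson_C4 S -> unstable (Cay S).
Proof.
move=> S_sym [even_n [m mU mS]].
have mulm_inj : injective (fun x => m * x) := mulrI mU.
have shift_inj : injective (fun x => Zn_half n + m * x).
  by move=> x y /addrI/(mulrI mU).
apply: (two_fold_unstable S_sym (f := perm mulm_inj) (g := perm shift_inj)).
  move=> x y; rewrite !permE /Cay -addrA -mulrBr.
  by rewrite -(mem_imset S (y - x) shift_inj) /= mS.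
apply/eqP=> /permP/(_ 0); rewrite !permE mulr0 addr0 => /esym/eqP.
by rewrite (negPf (Zn_half_neq0 n_gt1)).
Qed.

Lemma wilson_C4_pm_set (a b m : 'Z_n) : ~~ odd n -> m \is a GRing.unit ->
  m * a + Zn_half n \in pm_set a b -> m * b + Zn_half n \in pm_set a b ->
  wilson_C4 (pm_set a b).
Proof.
move=> even_n mU Sa Sb; apply: (wilson_C4I even_n mU) => s.
have sign_shift (e : bool) x :
    Zn_half n + m * ((-1) ^+ e * x) = (-1) ^+ e * (m * x + Zn_half n).
  by rewrite mulrDr mulr_sign_Zn_half //; ring.
case/pm_setP=> e [] ->; rewrite sign_shift mulr_sign.
  by case: e; rewrite ?pm_setN.
by case: e; rewrite ?pm_setN.
Qed.

Lemma case1_wilson_C4 (a b : 'Z_n) : case1 a b -> wilson_C4 (pm_set a b).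
Proof.
case=> n_mod4 _ [m [mU m2 bE]]; have even_n : ~~ odd n by lia.
apply: (wilson_C4_pm_set even_n mU); first by rewrite -bE pm_set_right.
rewrite bE mulrDr mulr_Zn_half // (odd_Zn_unit n_gt1 even_n mU) -addrA.
rewrite addr_Zn_half // addr0 mulrA -expr2 in_pm_set.
by case: m2 => ->; rewrite ?mul1r ?mulN1r eqxx ?orbT.
Qed.

Lemma Zn_unit_lift m l : (0 < m)%N -> coprime m l ->
  exists2 t : 'Z_n, t \is a GRing.unit &
    forall x : 'Z_n, (Zn_order x %| l)%N -> t * x = m%:R * x.
Proof.
move=> m_gt0 cop_ml.
have [k cop_n] := coprime_add_multiple m_gt0 (ltnW n_gt1) cop_ml.
exists (m + k * l)%:R => [|x ord_x]; first by rewrite unitZpE // coprime_sym.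
rewrite natrD mulrDl; suff /eqP-> : (k * l)%:R * x == 0 by rewrite addr0.
by rewrite Zn_order_dvd // dvdn_mull.
Qed.

(* The multiplier is [1 + |a| / 2] modulo [|a|] and [1 + |b| / 2] or
   [- 1 + |b| / 2] modulo [|b|]; the sign makes the two residues agree modulo
   [gcd(|a|, |b|) = 4]. *)
Lemma Zn_orders_wilson_C4 (a b : 'Z_n) A B : ~~ odd n ->
  Zn_order a = (2 * (2 * A))%N -> Zn_order b = (2 * (2 * B))%N ->
  coprime A B -> odd A -> wilson_C4 (pm_set a b).
Proof.
move=> even_n ordA ordB copAB odd_A.
have B_gt0 : (0 < B)%N by have := Zn_order_gt0 n_gt1 b; lia.
have [m [u [v [odd_u odd_v mA mB]]]] := coprime_odd_multiples B_gt0 copAB odd_A.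
have cop_m : coprime m (Zn_order a * Zn_order b).
  have := coprimeSn (2 * A * u); rewrite -mA !coprimeMr.
  case/andP=> /andP[cop2 copA] _.
  have copB : coprime m B.
    apply: (@coprime_dvdr _ (2 * B * v)); first by rewrite mulnAC dvdn_mull.
    by case: mB => [->|<-]; rewrite ?coprimeSn ?coprimenS.
  by rewrite ordA ordB !coprimeMr cop2 copA copB.
have [|t tU tE] := Zn_unit_lift _ cop_m; first by rewrite mA.
have fix_order x K w : Zn_order x = (2 * (2 * K))%N -> odd w ->
    (2 * K * w).+1%:R * x + Zn_half n = x.
  move=> ordx odd_w; rewrite -natr1 mulrDl mul1r.
  by rewrite (mulr_Zn_order_half _ _ ordx) // addrAC addr_Zn_half // add0r.
apply: (wilson_C4_pm_set even_n tU).
  by rewrite tE ?dvdn_mulr // mA fix_order // pm_set_left.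
rewrite tE ?dvdn_mull //; case: mB => mB.
  by rewrite mB fix_order // pm_set_right.
have mbE : m.+1%:R * b = Zn_half n by rewrite mB (mulr_Zn_order_half _ _ ordB).
have -> : m%:R * b = Zn_half n - b by rewrite -mbE -natr1; ring.
by rewrite addrAC addr_Zn_half // sub0r pm_setN pm_set_right.
Qed.

Lemma case2_wilson_C4 (a b : 'Z_n) : case2 a b -> wilson_C4 (pm_set a b).
Proof.
case=> n8 gcd4; have even_n : ~~ odd n by lia.
have [A ordA] : exists A, Zn_order a = (2 * (2 * A))%N.
  have /dvdnP[A ->] : (4 %| Zn_order a)%N by rewrite -gcd4 dvdn_gcdl.
  by exists A; lia.
have [B ordB] : exists B, Zn_order b = (2 * (2 * B))%N.
  have /dvdnP[B ->] : (4 %| Zn_order b)%N by rewrite -gcd4 dvdn_gcdr.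
  by exists B; lia.
have copAB : coprime A B.
  by move: gcd4; rewrite ordA ordB -!muln_gcdr /coprime; lia.
have [odd_A|even_A] := boolP (odd A).
  exact: (Zn_orders_wilson_C4 even_n ordA ordB copAB odd_A).
rewrite -pm_setC; rewrite coprime_sym in copAB.
apply: (Zn_orders_wilson_C4 even_n ordB ordA copAB).
by rewrite -coprimen2; apply: coprime_dvdr copAB; rewrite dvdn2.
Qed.

Lemma Zn_half_multiple_order (x : 'Z_n) k : ~~ odd n -> ~~ odd k ->
  k%:R * x = Zn_half n -> (Zn_order x %| k * 2)%N /\ (4 %| Zn_order x)%N.
Proof.
move=> even_n even_k kx; have ord_2k : (Zn_order x %| k * 2)%N.
  by rewrite -Zn_order_dvd // muln2 -addnn natrD mulrDl kx addr_Zn_half.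
split=> //; apply: (@dvdn_pfactor_succ 2 1 k) => //; first by rewrite dvdn2.
by rewrite -Zn_order_dvd // kx Zn_half_neq0.
Qed.

Section WilsonCases.

Variables a b : 'Z_n.
Hypotheses (even_n : ~~ odd n) (conn : graph_connected (Cay (pm_set a b))).
Hypotheses (odd_a : odd a) (even_b : ~~ odd b).

Lemma wilson_C4_multiplier : wilson_C4 (pm_set a b) ->
  exists m, [/\ m \is a GRing.unit,
    m * a + Zn_half n \in pm_set a b, m * b + Zn_half n \in pm_set a b,
    odd (m * a + Zn_half n)%R = ~~ odd (n %/ 2) &
    odd (m * b + Zn_half n)%R = odd (n %/ 2)].
Proof.
case=> _ [m mU mS]; exists m.
have shift s : s \in pm_set a b -> m * s + Zn_half n \in pm_set a b.
  by move=> Ss; rewrite addrC -mS; apply/imsetP; exists s.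
split; rewrite ?shift ?pm_set_left ?pm_set_right //.
- by rewrite odd_ZnD // odd_ZnM // odd_Zn_natr // (odd_Zn_unit n_gt1) // odd_a.
by rewrite odd_ZnD // odd_ZnM // odd_Zn_natr // (negPf even_b) andbF.
Qed.

Lemma wilson_C4_case1 : odd (n %/ 2) -> wilson_C4 (pm_set a b) -> case1 a b.
Proof.
move=> odd_half /wilson_C4_multiplier[m [mU Sma Smb odd_ma odd_mb]].
have [e maE] : exists e : bool, m * a + Zn_half n = (-1) ^+ e * b.
  by apply: (pm_set_even n_gt1 even_n odd_a); rewrite // odd_ma odd_half.
have [k mbE] : exists k : bool, m * b + Zn_half n = (-1) ^+ k * a.
  by apply: (pm_set_odd n_gt1 even_n even_b); rewrite // odd_mb.
pose m' := (-1) ^+ e * m.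
have m'U : m' \is a GRing.unit by rewrite unitrMl // unitrX // unitrN unitr1.
have bE : b = m' * a + Zn_half n.
  by rewrite -[LHS](signrMK e) -maE mulrDr mulr_sign_Zn_half // mulrA.
have aU : a \is a GRing.unit.
  apply: (@pm_set_divisor_unit _ a (m' + Zn_half n)).
  by rewrite mulrDr mulr_Zn_half // odd_a (mulrC a) -bE.
have mul_half : m' * Zn_half n = Zn_half n.
  by rewrite mulr_Zn_half // (odd_Zn_unit n_gt1).
have m'2 : m' ^+ 2 = (-1) ^+ e * (-1) ^+ k.
  apply: (mulIr aU).
  have -> : m' ^+ 2 * a = m' * (m' * a + Zn_half n) - m' * Zn_half n by ring.
  rewrite -bE mul_half.
  have -> : m' * b = (-1) ^+ e * (m * b + Zn_half n) - (-1) ^+ e * Zn_half n.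
    by rewrite /m'; ring.
  rewrite mbE mulr_sign_Zn_half // -mulrA -addrA -opprD.
  by rewrite addr_Zn_half // subr0.
split; first by lia.
  by rewrite gcdnC; apply/eqP; rewrite -[_ == _](unitZpE a n_gt1) natr_Zp.
exists m'; split=> //; rewrite m'2.
by case: (e) (k) => -[]; rewrite ?mulrNN ?mulr1 ?mul1r; [left|right|right|left].
Qed.

Lemma wilson_C4_even_multiplier : ~~ odd (n %/ 2) -> wilson_C4 (pm_set a b) ->
  exists p : 'Z_n,
    [/\ ~~ odd p, p%:R * a = Zn_half n & (p + 2)%:R * b = Zn_half n].
Proof.
move=> even_half /wilson_C4_multiplier[m [mU Sma Smb odd_ma odd_mb]].
have [e maE] : exists e : bool, m * a + Zn_half n = (-1) ^+ e * a.
  by apply: (pm_set_odd n_gt1 even_n even_b); rewrite // odd_ma.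
have [k mbE] : exists k : bool, m * b + Zn_half n = (-1) ^+ k * b.
  by apply: (pm_set_even n_gt1 even_n odd_a); rewrite // odd_mb.
pose p := (-1) ^+ e * m - 1.
have pE x : p * x = (-1) ^+ e * (m * x + Zn_half n) - x + Zn_half n.
  apply: (eq_of_subr_eq (esym (addr_Zn_half n_gt1 even_n))).
  by rewrite mulrDr mulr_sign_Zn_half // /p; ring.
have pa : p * a = Zn_half n by rewrite pE maE signrMK subrr add0r.
have pb : p * b = (-1) ^+ (e (+) k) * b - b + Zn_half n.
  by rewrite pE mbE mulrA signr_addb.
exists p; rewrite natrD !natr_Zp; split=> //.
  rewrite odd_ZnD // odd_Zn_sign // odd_ZnN // odd_Zn1 //.
  by rewrite (odd_Zn_unit n_gt1).
have [ek|nek] := boolP (e (+) k); first by rewrite mulrDl pb ek; ring.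
have pS : {in pm_set a b, forall s, p * s = Zn_half n}.
  move=> _ /pm_setP[l [->|->]]; rewrite mulrCA ?pa ?mulr_sign_Zn_half //.
  by rewrite pb (negPf nek) mul1r subrr add0r mulr_sign_Zn_half.
have := Zn_half_multiple_odd n_gt1 even_n conn pS (pm_set_right a b).
by rewrite (negPf even_b).
Qed.

Lemma wilson_C4_case2 : ~~ odd (n %/ 2) -> wilson_C4 (pm_set a b) -> case2 a b.
Proof.
move=> even_half /(wilson_C4_even_multiplier even_half)[p [even_p pa pb]].
have [ord_a a4] := Zn_half_multiple_order even_n even_p pa.
have [ord_b b4] : (Zn_order b %| (p + 2) * 2)%N /\ (4 %| Zn_order b)%N.
  by apply: Zn_half_multiple_order even_n _ pb; rewrite oddD addbF.
split.
  have -> : n = (Zn_order b * gcdn n b)%N by rewrite divnK // dvdn_gcdl.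
  by apply: (@dvdn_mul 4 2) => //; rewrite dvdn_gcd !dvdn2 even_n.
apply/eqP; rewrite eqn_dvd dvdn_gcd a4 b4 !andbT -(@dvdn_addr (p * 2)).
  have -> : (p * 2 + 4 = (p + 2) * 2)%N by rewrite mulnDl.
  exact: dvdn_trans (dvdn_gcdr _ _) ord_b.
exact: dvdn_trans (dvdn_gcdl _ _) ord_a.
Qed.

End WilsonCases.

End WilsonType.

Lemma nontrivially_unstable_even_modulus n (S : {set 'Z_n}) :
  (1 < n)%N -> symmetric (Cay S) -> nontrivially_unstable (Cay S) -> ~~ odd n.
Proof.
move=> n_gt1 S_sym [conn nbip tfree /(unstable_two_fold conn nbip)].
case=> f [g [fg nfg]]; apply: contra nfg => odd_n.
by apply/eqP; apply: odd_twin_free_two_fold_eq fg.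
Qed.

Lemma nontrivially_unstable_case n (a b : 'Z_n) :
  (1 < n)%N -> #|pm_set a b| = 4 -> nontrivially_unstable (Cay (pm_set a b)) ->
  odd a -> ~~ odd b -> case1 a b \/ case2 a b.
Proof.
move=> n_gt1 card4 ntriv odd_a even_b.
have even_n := nontrivially_unstable_even_modulus n_gt1 (Cay_sym a b) ntriv.
have [conn nbip tfree /(unstable_two_fold conn nbip)[f [g [fg nfg]]]] := ntriv.
have wilson : wilson_C4 (pm_set a b).
  have gf := two_fold_autC (Cay_sym a b) fg.
  by apply: (two_fold_wilson_C4 n_gt1 conn nbip fg) nfg;
    apply: pm_set_preserves_parallelograms.
have [odd_half|even_half] := boolP (odd (n %/ 2)).
  by left; apply: wilson_C4_case1.
by right; apply: wilson_C4_case2.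
Qed.

Lemma pm_set_mixed_parity n (a b : 'Z_n) : (1 < n)%N -> ~~ odd n ->
  graph_connected (Cay (pm_set a b)) -> ~ graph_bipartite (Cay (pm_set a b)) ->
  odd a /\ ~~ odd b \/ odd b /\ ~~ odd a.
Proof.
move=> n_gt1 even_n conn nbip.
have [s Ss odd_s] := connected_odd_mem n_gt1 even_n conn.
have [t St even_t] := nonbipartite_even_mem n_gt1 even_n nbip.
have /pm_setP[e [Ds|Ds]] := Ss; have /pm_setP[k [Dt|Dt]] := St;
  move: odd_s even_t; rewrite Ds Dt !odd_Zn_sign //; auto; by move->.
Qed.

Lemma Cay_valency n (S : {set 'Z_n}) k : has_valency (Cay S) k -> #|S| = k.
Proof.
move/(_ 0); suff -> : nbhd (Cay S) 0 = S by [].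
by apply/setP=> u; rewrite inE /Cay subr0.
Qed.

Theorem theorem4p3 (n : nat) (n_gt1 : (1 < n)%N) (a b : 'Z_n)
    (S_no0 : 0 \notin pm_set a b)
    (valency4 : has_valency (Cay (pm_set a b)) 4) :
  (unstable (Cay (pm_set a b)) <->
     trivially_unstable (Cay (pm_set a b)) \/
     ((case1 a b \/ case2 a b) \/ (case1 b a \/ case2 b a))) /\
  ((case1 a b \/ case2 a b) \/ (case1 b a \/ case2 b a) ->
     wilson_C4 (pm_set a b)).
Proof.
have cases_wilson : (case1 a b \/ case2 a b) \/ (case1 b a \/ case2 b a) ->
    wilson_C4 (pm_set a b).
  by case=> -[/(case1_wilson_C4 n_gt1)|/(case2_wilson_C4 n_gt1)];
    rewrite // pm_setC.
split=> //; split; last first.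
  by case=> [[]//|/cases_wilson]; apply: wilson_C4_unstable (Cay_sym a b).
move=> unst; have card4 := Cay_valency valency4.
case: (Classical_Prop.classic (nontrivially_unstable (Cay (pm_set a b)))).
  move=> ntriv; right; have [conn nbip _ _] := ntriv.
  have even_n := nontrivially_unstable_even_modulus n_gt1 (Cay_sym a b) ntriv.
  have [[odd_a even_b]|[odd_b even_a]] :=
    pm_set_mixed_parity n_gt1 even_n conn nbip.
    by left; apply: nontrivially_unstable_case.
  by right; apply: nontrivially_unstable_case; rewrite // pm_setC.
by left.
Qed.
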